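(* Let $k\ge l\ge0$ be integers. Let $\alpha_1,\alpha_2\in\{0,\dots,l\}$ and $\beta_n\in\{0,\dots,l-\alpha_n\}$ for $n=1,2$, with $(\alpha_1,\beta_1)\neq(\alpha_2,\beta_2)$. Then $$[C^{\alpha_1}S_u^{\beta_1}H,\;C^{\alpha_2}S_u^{\beta_2}G]_F=0$$ for all $H\in\mathcal{H}_{k-\alpha_1+\beta_1,\,l-\alpha_1-\beta_1}(\mathbb{R}^{2m},\mathbb{C})$ and $G\in\mathcal{H}_{k-\alpha_2+\beta_2,\,l-\alpha_2-\beta_2}(\mathbb{R}^{2m},\mathbb{C})$.
   Context: Fix an integer $m>4$. For $x,u\in\mathbb{R}^m$ let $\mathcal{P}_{p,q}(\mathbb{R}^{2m},\mathbb{C})$ be complex polynomials of degree $p$ in $x$ and $q$ in $u$. The Fischer inner product is $[P,Q]_F=\overline{P}(\partial_x,\partial_u)Q(x,u)\big|_{x=u=0}$ ($\overline{P}(\partial_x,\partial_u)$: conjugate coefficients of $P$ and replace $x_j,u_j$ by $\partial_{x_j},\partial_{u_j}$). Write $|x|^2=\sum x_j^2$, $\langle u,x\rangle=\sum u_jx_j$, $\Delta_x=\sum\partial_{x_j}^2$, $\Delta_u=\sum\partial_{u_j}^2$, $\langle\partial_u,\partial_x\rangle=\sum\partial_{u_j}\partial_{x_j}$, $\langle x,\partial_u\rangle=\sum x_j\partial_{u_j}$, $\langle u,\partial_x\rangle=\sum u_j\partial_{x_j}$, $\ker(D_1,\dots,D_r)=\bigcap\ker D_i$. Every $P\in\mathcal{P}_{p,q}$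 is uniquely $\sum_{a,b\ge0}|x|^{2a}|u|^{2b}H'_{p-2a,q-2b}$ with $H'_{p-2a,q-2b}\in\mathcal{P}_{p-2a,q-2b}\cap\ker(\Delta_x,\Delta_u)$; $\pi_{\mathfrak{s}}P:=H'_{p,q}$. On $\ker(\Delta_x,\Delta_u)$: $S_u=\pi_{\mathfrak{s}}\langle u,\partial_x\rangle$, $C=\pi_{\mathfrak{s}}\langle u,x\rangle$. For $a\ge b\ge0$, $\mathcal{H}_{a,b}=\mathcal{P}_{a,b}\cap\ker(\Delta_x,\Delta_u,\langle\partial_u,\partial_x\rangle,\langle x,\partial_u\rangle)$. *)

(* Defs.v *)
From HB Require Import structures.
From mathcomp Require Import all_boot all_order all_algebra.
From mathcomp Require Import reals.
From mathcomp Require Import complex.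
From mathcomp Require Import mpoly.
From Stdlib Require Import ClassicalEpsilon.
Set Implicit Arguments. Unset Strict Implicit. Unset Printing Implicit Defensive.
Import GRing.Theory Num.Theory.
Local Open Scope ring_scope.

Section Defs.
Variables (R : realType) (m : nat).

(* complex polynomials in (x,u) in R^m x R^m = R^(2m):
   variable lshift m j is x_j, variable rshift m j is u_j *)
Definition cpoly := {mpoly R[i][m + m]}.

Definition xv (j : 'I_m) : cpoly := 'X_(lshift m j).
Definition uv (j : 'I_m) : cpoly := 'X_(rshift m j).
Definition dx (j : 'I_m) (p : cpoly) : cpoly := p^`M(lshift m j).
Definition du (j : 'I_m) (p : cpoly) : cpoly := p^`M(rshift m j).

Definition normx2 : cpoly := \sum_(j < m) xv j ^+ 2.
Definition normu2 : cpoly := \sum_(j < m) uv j ^+ 2.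
Definition ux : cpoly := \sum_(j < m) uv j * xv j.

Definition Lapx (p : cpoly) : cpoly := \sum_(j < m) dx j (dx j p).
Definition Lapu (p : cpoly) : cpoly := \sum_(j < m) du j (du j p).
Definition DuDx (p : cpoly) : cpoly := \sum_(j < m) du j (dx j p).
Definition xDu (p : cpoly) : cpoly := \sum_(j < m) xv j * du j p.
Definition uDx (p : cpoly) : cpoly := \sum_(j < m) uv j * dx j p.

Definition bihomog (a b : nat) (p : cpoly) : Prop :=
  forall mon, mon \in msupp p ->
    (\sum_(j < m) mon (lshift m j) = a)%N /\ (\sum_(j < m) mon (rshift m j) = b)%N.

Definition harmonic (p : cpoly) : Prop := Lapx p = 0 /\ Lapu p = 0.

Definition Hspace (a b : nat) (p : cpoly) : Prop :=
  [/\ bihomog a b p, Lapx p = 0, Lapu p = 0, DuDx p = 0 & xDu p = 0].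

Definition fischer (P Q : cpoly) : R[i] :=
  (\sum_(mon <- msupp P) (P@_mon)^* *: Q^`M[mon]).@[fun _ => 0].

Definition fischer_decomp (p q : nat) (P : cpoly) (Hf : nat -> nat -> cpoly) : Prop :=
  (forall a b, (a <= p./2)%N -> (b <= q./2)%N ->
     bihomog (p - 2 * a)%N (q - 2 * b)%N (Hf a b) /\ harmonic (Hf a b)) /\
  P = \sum_(a < p./2.+1) \sum_(b < q./2.+1) normx2 ^+ a * normu2 ^+ b * Hf a b.

Definition pi_s (P : cpoly) : cpoly :=
  epsilon (inhabits 0) (fun H => exists p q Hf,
    [/\ bihomog p q P, fischer_decomp p q P Hf & H = Hf 0%N 0%N]).

Definition Su (P : cpoly) : cpoly := pi_s (uDx P).
Definition Cop (P : cpoly) : cpoly := pi_s (ux * P).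

End Defs.

(* Main.v *)
(** The operators [<v_s,v_t>], [<v_s,d_t>], [<d_s,d_t>] ([v_s], [v_t] among [x], [u]) span a copy
    of sp(4). On simultaneous harmonics [C] has an explicit form [cop], a polynomial in these
    operators, and is adjoint to [D = <d_u,d_x>] for the Fischer product. The key identity is
    [D C P = c P + c' C D P] on harmonics that are eigenvectors of the Casimir operator of sp(4),
    which commutes with [C] and [<u,d_x>] and acts by a scalar on the spaces [H_{a,b}].
    Hence [D C^(n+1) P] is a multiple of [C^n P] whenever [D P = 0], and pairing
    [C^a1 S_u^b1 H] with [C^a2 S_u^b2 G] gives zero unless [a1 = a2]. On [ker D] the operator
    [S_u] is just [<u,d_x>], with adjoint [<x,d_u>], and the same ladder argument for this
    sl(2) gives zero unless [b1 = b2]. *)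
Require Import Defs.
From HB Require Import structures.
From mathcomp Require Import all_boot all_order all_algebra.
From mathcomp Require Import reals complex mpoly.
From mathcomp Require Import ring zify.
From Stdlib Require Import ClassicalEpsilon.
Import GRing.Theory Num.Theory.
Set Implicit Arguments. Unset Strict Implicit. Unset Printing Implicit Defensive.
Local Open Scope ring_scope.

(** * The quadratic operators of sp(4) on polynomials and their commutators *)

Section Operators.
Variables (R : realType) (m : nat).
Implicit Types (P Q : cpoly R m) (s t r w : bool) (c : R[i]).

(* [false] stands for the block of variables x, [true] for u; thus [lap true false] is [DuDx]. *)
Definition idx s (j : 'I_m) : 'I_(m + m) := if s then rshift m j else lshift m j.
Definition var s (j : 'I_m) : cpoly R m := 'X_(idx s j).
Definition der s (j : 'I_m) P : cpoly R m := P^`M(idx s j).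
Definition mulop s t : cpoly R m := \sum_(j < m) var s j * var t j.
Definition polar s t P : cpoly R m := \sum_(j < m) var s j * der t j P.
Definition lap s t P : cpoly R m := \sum_(j < m) der s j (der t j P).

Lemma der_var s t i j : der s i (var t j) = (s == t)%:R *+ (i == j).
Proof.
rewrite /der /var mderivX mnm1E.
have -> : (idx t j == idx s i) = (s == t) && (i == j).
  rewrite eq_sym; case: s t => [] [] /=.
  - exact: (inj_eq (@rshift_inj _ _)).
  - by rewrite eq_rlshift.
  - by rewrite eq_lrshift.
  - exact: (inj_eq (@lshift_inj _ _)).
case: (eqVneq s t) => [->|_] /=; last by rewrite scale0r mul0rn.
case: (eqVneq i j) => [->|_] /=; last by rewrite scale0r.
by rewrite scale1r -[X in (X - _)%MM]add0m addmK mpolyX0.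
Qed.

Lemma derM s j P Q : der s j (P * Q) = der s j P * Q + P * der s j Q.
Proof. exact: mderivM. Qed.

HB.instance Definition _ s j := GRing.Linear.copy (der s j) (mderiv (idx s j)).

Lemma polar_is_linear s t : linear (polar s t).
Proof.
move=> c P Q; rewrite /polar scaler_sumr -big_split; apply: eq_bigr => j _ /=.
by rewrite linearP mulrDr scalerAr.
Qed.
HB.instance Definition _ s t :=
  GRing.isLinear.Build _ _ _ _ (polar s t) (polar_is_linear s t).

Lemma lap_is_linear s t : linear (lap s t).
Proof.
move=> c P Q; rewrite /lap scaler_sumr -big_split; apply: eq_bigr => j _ /=.
by rewrite !linearP.
Qed.
HB.instance Definition _ s t :=
  GRing.isLinear.Build _ _ _ _ (lap s t) (lap_is_linear s t).

Lemma mulopC s t : mulop s t = mulop t s.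
Proof. by apply: eq_bigr => j _; rewrite mulrC. Qed.

Lemma lapC s t P : lap s t P = lap t s P.
Proof. by apply: eq_bigr => j _; apply: mderiv_comm. Qed.

Lemma der_comm s i t j P : der s i (der t j P) = der t j (der s i P).
Proof. exact: mderiv_comm. Qed.

Lemma der_lap s j r w P : der s j (lap r w P) = lap r w (der s j P).
Proof.
rewrite /lap linear_sum; apply: eq_bigr => i _ /=.
by rewrite der_comm (der_comm s j).
Qed.

Lemma lap_lap s t r w P : lap s t (lap r w P) = lap r w (lap s t P).
Proof.
rewrite {1}/lap; under eq_bigr => j _ do rewrite !der_lap.
by rewrite -linear_sum.
Qed.

Lemma polarM s t P Q : polar s t (P * Q) = polar s t P * Q + P * polar s t Q.
Proof.
rewrite /polar mulr_suml mulr_sumr -big_split; apply: eq_bigr => j _ /=.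
by rewrite derM; ring.
Qed.

Lemma polar_var s t r j : polar s t (var r j) = var s j *+ (t == r).
Proof.
rewrite /polar (bigD1 j) //= big1 => [|i /negbTE ij]; rewrite der_var.
  by rewrite eqxx mulr1n addr0 mulr_natr.
by rewrite ij mulr0n mulr0.
Qed.

Lemma der_mulop t r w j :
  der t j (mulop r w) = var w j *+ (t == r) + var r j *+ (t == w).
Proof.
rewrite /mulop linear_sum (bigD1 j) //= big1 => [|i /negbTE ij].
  by rewrite derM !der_var eqxx !mulr1n addr0 mulr_natr mulr_natl.
by rewrite derM !der_var (eq_sym j) ij !mulr0n mul0r mulr0 addr0.
Qed.

Lemma polar_mulop s t r w P :
  polar s t (mulop r w * P) =
  mulop r w * polar s t P + (mulop s w *+ (t == r) + mulop r s *+ (t == w)) * P.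
Proof.
rewrite polarM addrC; congr (_ + _ * _).
rewrite {1}/mulop linear_sum /=.
under eq_bigr => j _ do rewrite polarM !polar_var mulrnAl mulrnAr.
by rewrite big_split /= !sumrMnl.
Qed.

Lemma der_polar t j r w P :
  der t j (polar r w P) = polar r w (der t j P) + der w j P *+ (t == r).
Proof.
rewrite /polar linear_sum /=.
under eq_bigr => i _ do rewrite derM der_var der_comm.
rewrite big_split addrC /=; congr (_ + _).
rewrite (bigD1 j) //= big1 ?addr0 => [|i /negbTE ij].
  by rewrite eqxx mulr1n mulr_natl.
by rewrite (eq_sym j) ij mulr0n mul0r.
Qed.

Lemma lap_polar s t r w P :
  lap s t (polar r w P) =
  polar r w (lap s t P) + lap t w P *+ (s == r) + lap s w P *+ (t == r).
Proof.
have termE j : der s j (der t j (polar r w P)) =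
    polar r w (der s j (der t j P))
    + der t j (der w j P) *+ (s == r) + der s j (der w j P) *+ (t == r).
  by rewrite der_polar linearD linearMn /= der_polar (der_comm w j t j).
by rewrite /lap (eq_bigr _ (fun j _ => termE j)) !big_split /= linear_sum !sumrMnl.
Qed.

(** Leibniz rule twice: one derivative on each factor gives the four [polar] terms, both derivatives
    on the quadratic form give the scalar term, in which [m] counts the coordinates. *)
Lemma lap_mulop s t r w P :
  lap s t (mulop r w * P) =
  mulop r w * lap s t P
  + polar w t P *+ (s == r) + polar r t P *+ (s == w)
  + polar w s P *+ (t == r) + polar r s P *+ (t == w)
  + P *+ (m * ((s == w) && (t == r) + (s == r) && (t == w))).
Proof.
have termE j : der s j (der t j (mulop r w * P)) =
    mulop r w * der s j (der t j P)
  + (var w j * der t j P) *+ (s == r) + (var r j * der t j P) *+ (s == w)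
  + (var w j * der s j P) *+ (t == r) + (var r j * der s j P) *+ (t == w)
  + P *+ ((s == w) && (t == r) + (s == r) && (t == w)).
  rewrite derM der_mulop linearD /= !derM !linearD !linearMn /= !der_var.
  rewrite der_mulop eqxx !mulr1n -!mulnb mulrnDr !mulrnA.
  by case: (s == r) (s == w) (t == r) (t == w) => [] [] [] [] /=; ring.
rewrite /lap (eq_bigr _ (fun j _ => termE j)) !big_split /= -mulr_sumr !sumrMnl.
by rewrite sumr_const card_ord -mulrnA mulnC.
Qed.

Lemma polar_polar s t r w P :
  polar s t (polar r w P) =
  polar r w (polar s t P) + polar s w P *+ (t == r) - polar r t P *+ (s == w).
Proof.
rewrite [polar s t (polar r w P)]/polar.
under eq_bigr => j _ do rewrite der_polar mulrDr mulrnAr.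
rewrite big_split /= sumrMnl.
rewrite [in RHS]/(polar s t P) [polar r w (\sum_j _)]linear_sum /=.
under [in RHS]eq_bigr => j _ do rewrite polarM polar_var eq_sym mulrnAl.
by rewrite big_split /= sumrMnl; rewrite -!/(polar _ _ _); ring.
Qed.
End Operators.

(** * The Fischer inner product: definiteness and adjoint operators *)

Section Fischer.
Variables (R : realType) (m : nat).
Implicit Types (P Q T : cpoly R m) (c : R[i]) (mon : 'X_{1..m + m}).

Lemma meval_0 P : P.@[fun _ => 0] = P@_0.
Proof.
rewrite [P in LHS]mpolyE [P in RHS]mpolyE !linear_sum /=; apply: eq_bigr => mon _.
rewrite !linearZ /= mevalX mcoeffX; congr (_ * _).
case: eqP => [->|mon0].
  by rewrite big1 // => i _; rewrite mnm0E expr0.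
have [i moni|all0] := pickP (fun i => mon i != 0%N).
  by rewrite (bigD1 i) //= expr0n (negbTE moni) mul0r.
by case: mon0; apply/mnmP => i; rewrite mnm0E; apply/eqP/negbFE/all0.
Qed.

Definition mnm_fact mon : nat := \prod_(i < m + m) (mon i)`!.

(** Monomials are orthogonal, with square norm [mnm_fact]. Allowing any [S] that contains the
    support puts pairings of different polynomials over one index set. *)
Lemma fischer_coefE S P Q : uniq S -> {subset msupp P <= S} ->
  fischer P Q = \sum_(mon <- S) (P@_mon)^* * (Q@_mon *+ mnm_fact mon).
Proof.
move=> uS PS; transitivity
  (\sum_(mon <- msupp P) (P@_mon)^* * (Q@_mon *+ mnm_fact mon)).
  rewrite /fischer linear_sum; apply: eq_bigr => mon _ /=.
  rewrite mevalZ meval_0 mcoeff_mderivm addm0; congr (_ * (_ *+ _)).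
  by apply: eq_bigr => i _; rewrite ffactnn.
rewrite [RHS](bigID (mem (msupp P))) /= [X in _ = _ + X]big1 ?addr0; last first.
  by move=> mon; rewrite -mcoeff_eq0 => /eqP ->; rewrite conjC0 mul0r.
rewrite -[RHS]big_filter; apply: perm_big; apply: uniq_perm => [||mon].
- exact: msupp_uniq.
- exact: filter_uniq.
- by rewrite mem_filter andb_idr // => /PS.
Qed.

Lemma fischerDl P Q T : fischer (P + Q) T = fischer P T + fischer Q T.
Proof.
pose S := undup (msupp P ++ msupp Q ++ msupp (P + Q)).
have sub mon :
    mon \in S = [|| mon \in msupp P, mon \in msupp Q | mon \in msupp (P + Q)].
  by rewrite mem_undup !mem_cat.
rewrite !(@fischer_coefE S) ?undup_uniq //; try by move=> mon; rewrite sub => ->; rewrite ?orbT.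
rewrite -big_split; apply: eq_bigr => mon _ /=.
by rewrite mcoeffD rmorphD mulrDl.
Qed.

Lemma fischerZr c P Q : fischer P (c *: Q) = c * fischer P Q.
Proof.
rewrite !(@fischer_coefE (msupp P)) ?msupp_uniq // mulr_sumr.
by apply: eq_bigr => mon _; rewrite mcoeffZ; ring.
Qed.

Lemma fischerC P Q : fischer P Q = (fischer Q P)^*.
Proof.
pose S := undup (msupp P ++ msupp Q).
have sub mon : mon \in S = (mon \in msupp P) || (mon \in msupp Q).
  by rewrite mem_undup mem_cat.
rewrite !(@fischer_coefE S) ?undup_uniq //; try by move=> mon; rewrite sub => ->; rewrite ?orbT.
rewrite rmorph_sum; apply: eq_bigr => mon _ /=.
by rewrite rmorphM /= conjCK rmorphMn /= !mulrnAr mulrC.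
Qed.

Lemma fischerDr P Q T : fischer P (Q + T) = fischer P Q + fischer P T.
Proof. by rewrite !(fischerC P) fischerDl rmorphD. Qed.

Lemma fischer0l Q : fischer 0 Q = 0.
Proof. by rewrite /fischer msupp0 big_nil meval0. Qed.

Lemma fischer0r P : fischer P 0 = 0.
Proof. by rewrite fischerC fischer0l conjC0. Qed.

Lemma fischerZl c P Q : fischer (c *: P) Q = c^* * fischer P Q.
Proof. by rewrite fischerC fischerZr rmorphM /= -(fischerC P). Qed.

Lemma fischer_suml (I : Type) (r : seq I) (F : I -> cpoly R m) Q :
  fischer (\sum_(i <- r) F i) Q = \sum_(i <- r) fischer (F i) Q.
Proof.
by elim/big_rec2: _ => [|i x y _ <-]; rewrite ?fischer0l ?fischerDl.
Qed.

Lemma fischer_sumr (I : Type) (r : seq I) (F : I -> cpoly R m) P :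
  fischer P (\sum_(i <- r) F i) = \sum_(i <- r) fischer P (F i).
Proof.
by elim/big_rec2: _ => [|i x y _ <-]; rewrite ?fischer0r ?fischerDr.
Qed.

(** Each term is a squared modulus times a positive factorial weight, so a vanishing sum kills every
    coefficient. *)
Lemma fischer_definite P : fischer P P = 0 -> P = 0.
Proof.
rewrite (@fischer_coefE (msupp P)) ?msupp_uniq // => /eqP.
rewrite big_seq psumr_eq0 => [/allP all0|mon _]; last first.
  by rewrite mulrnAr mulrn_wge0 // mulrC -normCK exprn_ge0.
apply/mpolyP => mon; rewrite mcoeff0; apply/eqP; rewrite mcoeff_eq0.
apply/negP => monP; have := all0 mon monP; rewrite monP /=.
rewrite mulrnAr mulrC -normCK mulrn_eq0 -leqn0 leqNgt prodn_gt0 /=.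
  by rewrite expf_eq0 normr_eq0 mcoeff_eq0 monP.
by move=> i; rewrite fact_gt0.
Qed.

(** Multiplication by a variable shifts the support by one unit, which costs one more derivative of
    [Q]. *)
Lemma fischer_var s j P Q : fischer (var R s j * P) Q = fischer P (der s j Q).
Proof.
rewrite /fischer mulrC (perm_big _ (msuppMX _ _)) big_map /=; congr (_.@[_]).
by apply: eq_bigr => mon _; rewrite mcoeffMX mderivmDm mderivmU1m.
Qed.

Lemma fischer_der s j P Q : fischer (der s j P) Q = fischer P (var R s j * Q).
Proof. by rewrite fischerC -fischer_var -fischerC. Qed.

Lemma fischer_mulop s t P Q : fischer (mulop R m s t * P) Q = fischer P (lap s t Q).
Proof.
rewrite mulr_suml fischer_suml fischer_sumr; apply: eq_bigr => j _.
by rewrite -mulrA !fischer_var /der mderiv_comm.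
Qed.

Lemma fischer_polar s t P Q : fischer (polar s t P) Q = fischer P (polar t s Q).
Proof.
rewrite fischer_suml fischer_sumr; apply: eq_bigr => j _.
by rewrite fischer_var fischer_der.
Qed.
End Fischer.

(* The relations between [mulop], [polar] and [lap], over an abstract ring so that [ring] treats
   the values of the operators as atoms. *)
Record sp4_relations (K : fieldType) (A : comNzRingType)
    (cst : {rmorphism K -> A}) (m : nat)
    (M : bool -> bool -> A) (polar lap : bool -> bool -> A -> A) : Prop := {
  rel_polarD : forall s t P Q, polar s t (P + Q) = polar s t P + polar s t Q;
  rel_polarZ : forall s t c P, polar s t (cst c * P) = cst c * polar s t P;
  rel_lapD : forall s t P Q, lap s t (P + Q) = lap s t P + lap s t Q;
  rel_lapZ : forall s t c P, lap s t (cst c * P) = cst c * lap s t P;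
  rel_mulopC : forall s t, M s t = M t s;
  rel_lapC : forall s t P, lap s t P = lap t s P;
  rel_lap_lap : forall s t r w P, lap s t (lap r w P) = lap r w (lap s t P);
  rel_polar_mulop : forall s t r w P,
    polar s t (M r w * P) =
    M r w * polar s t P + (M s w *+ (t == r) + M r s *+ (t == w)) * P;
  rel_lap_polar : forall s t r w P,
    lap s t (polar r w P) =
    polar r w (lap s t P) + lap t w P *+ (s == r) + lap s w P *+ (t == r);
  rel_lap_mulop : forall s t r w P,
    lap s t (M r w * P) =
    M r w * lap s t P
    + polar w t P *+ (s == r) + polar r t P *+ (s == w)
    + polar w s P *+ (t == r) + polar r s P *+ (t == w)
    + P *+ (m * ((s == w) && (t == r) + (s == r) && (t == w)));
  rel_polar_polar : forall s t r w P,
    polar s t (polar r w P) =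
    polar r w (polar s t P) + polar s w P *+ (t == r) - polar r t P *+ (s == w)
}.

(** * Calculus with the sp(4) relations: the Casimir operator and the explicit form of [C] *)

Section Sp4.
Variables (K : fieldType) (A : comNzRingType) (cst : {rmorphism K -> A}) (m : nat).
Variables (M : bool -> bool -> A) (polar lap : bool -> bool -> A -> A).
Implicit Types (P Q T : A) (c a b p q : K) (s t r w : bool).

Local Notation x := false.
Local Notation u := true.

(** On polynomials this is also the Casimir operator of so(m), the sum over [i < j] of the squared
    rotation generators, which explains why it commutes with every rotation-invariant operator. The
    linear term comes from the ordering of the factors. *)
Definition sp4_casimir P : A :=
  M x x * lap x x P + M u u * lap u u P + (M u x * lap u x P) *+ 2
  - polar x x (polar x x P) - polar u u (polar u u P)
  - polar u x (polar x u P) - polar x u (polar u x P)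
  + cst (3%:R - m%:R) * (polar x x P + polar u u P).

(** The degrees are scalars of [K], so that lowering them never truncates; negative ones are dealt
    with by [polar_eigen_neg]. *)
Definition sp4_harmonic p q P : Prop :=
  [/\ lap x x P = 0, lap u u P = 0,
      polar x x P = cst p * P & polar u u P = cst q * P].

(* Equals [C P] on harmonics of bidegree (p,q) for [a = 1/(m+2p-2)], [b = 1/(m+2q-2)]:
   the projections along [|x|^2] and [|u|^2] applied one after the other. *)
Definition sp4_cop a b P : A :=
  M u x * P - cst a * (M x x * polar u x P) - cst b * (M u u * polar x u P)
  + cst (a * b) * (M x x * (M u u * lap u x P)).

Hypothesis rel : sp4_relations cst m M polar lap.
Let polarD := rel_polarD rel.
Let polarZ := rel_polarZ rel.
Let lapD := rel_lapD rel.
Let lapZ := rel_lapZ rel.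
Let mulopC := rel_mulopC rel.
Let lapC := rel_lapC rel.
Let lap_lap := rel_lap_lap rel.
Let polar_mulop := rel_polar_mulop rel.
Let lap_polar := rel_lap_polar rel.
Let lap_mulop := rel_lap_mulop rel.
Let polar_polar := rel_polar_polar rel.
Let mulop_xu : M x u = M u x. Proof. exact: mulopC. Qed.
Let lap_xu P : lap x u P = lap u x P. Proof. exact: lapC. Qed.
Let polarN s t P : polar s t (- P) = - polar s t P.
Proof. by rewrite -mulN1r -[RHS]mulN1r -(rmorphN1 cst) polarZ. Qed.
Let polarMn s t n P : polar s t (P *+ n) = polar s t P *+ n.
Proof. by rewrite -mulr_natl -[RHS]mulr_natl -(rmorph_nat cst) polarZ. Qed.
Let lapN s t P : lap s t (- P) = - lap s t P.
Proof. by rewrite -mulN1r -[RHS]mulN1r -(rmorphN1 cst) lapZ. Qed.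
Let lapMn s t n P : lap s t (P *+ n) = lap s t P *+ n.
Proof. by rewrite -mulr_natl -[RHS]mulr_natl -(rmorph_nat cst) lapZ. Qed.
Let polar0 s t : polar s t 0 = 0.
Proof. by rewrite -[in LHS](mul0r 0) -(rmorph0 cst) polarZ rmorph0 mul0r. Qed.
Let lap0 s t : lap s t 0 = 0.
Proof. by rewrite -[in LHS](mul0r 0) -(rmorph0 cst) lapZ rmorph0 mul0r. Qed.
Let mD := (polar0, lap0, polarD, lapD, polarN, lapN, polarMn, lapMn, polarZ, lapZ).
Let simp := (mulr0n, mulr1n, addr0, add0r, muln0, muln1, subr0, mul0r, mulrDl, mulop_xu, lap_xu).

Lemma casimir_mulop r w P : sp4_casimir (M r w * P) = M r w * sp4_casimir P.
Proof.
rewrite /sp4_casimir (rmorphB cst) !(rmorph_nat cst) !lap_mulop !polar_mulop.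
case: r w => [] [] /=; rewrite !(simp, mD, polar_mulop) /= ?simp; ring.
Qed.

Lemma casimir_polar_ux P : sp4_casimir (polar u x P) = polar u x (sp4_casimir P).
Proof.
(* Only the instances that move [polar u x] inward are listed: the general relation swaps any two
   operators and applies again to its own result. *)
rewrite /sp4_casimir; rewrite !(mD, polar_mulop, lap_polar, polar_polar u x x x,
  polar_polar u x u u, polar_polar u x x u) /=; rewrite ?(simp, mD).
ring.
Qed.

Lemma casimir_polar_xu P : sp4_casimir (polar x u P) = polar x u (sp4_casimir P).
Proof.
rewrite /sp4_casimir; rewrite !(mD, polar_mulop, lap_polar, polar_polar x u x x,
  polar_polar x u u u, polar_polar x u u x) /=; rewrite ?(simp, mD); ring.
Qed.

Lemma casimir_lap_ux P : sp4_casimir (lap u x P) = lap u x (sp4_casimir P).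
Proof.
rewrite /sp4_casimir; rewrite !(mD, lap_mulop, lap_polar, lap_lap u x) /=.
rewrite ?(simp, mD) (rmorphB cst) !(rmorph_nat cst); ring.
Qed.

Lemma casimirD P Q : sp4_casimir (P + Q) = sp4_casimir P + sp4_casimir Q.
Proof. by rewrite /sp4_casimir !mD; ring. Qed.

Lemma casimirZ c P : sp4_casimir (cst c * P) = cst c * sp4_casimir P.
Proof. by rewrite /sp4_casimir !mD; ring. Qed.

Lemma copZ a b c P : sp4_cop a b (cst c * P) = cst c * sp4_cop a b P.
Proof. by rewrite /sp4_cop !mD; ring. Qed.

Lemma cop0 a b : sp4_cop a b 0 = 0.
Proof. by rewrite /sp4_cop !mD !mulr0 !subr0 addr0. Qed.

Lemma casimir_cop a b P : sp4_casimir (sp4_cop a b P) = sp4_cop a b (sp4_casimir P).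
Proof.
rewrite /sp4_cop -!mulNr -!(rmorphN cst) !(casimirD, casimirZ, casimir_mulop).
by rewrite casimir_polar_ux casimir_polar_xu casimir_lap_ux.
Qed.

(** The only obstruction is the commutator of [lap u u] with [polar u x], which is [2 * lap u x] and
    kills [P]. *)
Lemma harmonic_polar_ux p q P :
  sp4_harmonic p q P -> lap u x P = 0 -> sp4_harmonic (p - 1) (q + 1) (polar u x P).
Proof.
case=> Lx Lu Ex Eu D0; split; rewrite ?lap_polar /= ?(Lx, Lu, D0) ?(simp, mD) //.
- by rewrite polar_polar /= ?simp Ex mD rmorphB rmorph1; ring.
- by rewrite polar_polar /= ?simp Eu mD rmorphD rmorph1; ring.
Qed.

Lemma lap_ux_polar_ux p q P : sp4_harmonic p q P ->
  lap u x (polar u x P) = polar u x (lap u x P).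
Proof. by case=> Lx _ _ _; rewrite lap_polar /= ?simp Lx addr0. Qed.

Lemma polar_xu_polar_ux p q P : sp4_harmonic p q P ->
  polar x u (polar u x P) = polar u x (polar x u P) + cst (p - q) * P.
Proof.
by case=> _ _ Ex Eu; rewrite polar_polar /= ?simp Ex Eu rmorphB; ring.
Qed.

Lemma harmonicZ p q c P : sp4_harmonic p q P -> sp4_harmonic p q (cst c * P).
Proof. by case=> Lx Lu Ex Eu; split; rewrite mD ?(Lx, Lu, Ex, Eu) ?mulr0 //; ring. Qed.

Lemma harmonic_lap_ux p q P :
  sp4_harmonic p q P -> sp4_harmonic (p - 1) (q - 1) (lap u x P).
Proof.
case=> Lx Lu Ex Eu; split; try by rewrite lap_lap ?(Lx, Lu) mD.
- have := lap_polar u x x x P; rewrite Ex /= ?(simp, mD) => /eqP.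
  by rewrite -subr_eq => /eqP <-; rewrite rmorphB rmorph1; ring.
- have := lap_polar u x u u P; rewrite Eu /= ?(simp, mD) => /eqP.
  by rewrite -subr_eq => /eqP <-; rewrite rmorphB rmorph1; ring.
Qed.

(** Laplacians of the corrected expressions below leave exactly this factor; its vanishing fixes the
    weights. *)
Let weight_cst a p : a * (m%:R + 2 * p - 2) = 1 ->
  1 - cst a * (m%:R + 2 * cst p - 2) = 0.
Proof.
move=> ha; rewrite -[X in X - _](rmorph1 cst) -[X in cst X - _]ha.
by rewrite !(rmorphM cst, rmorphB cst, rmorphN cst, rmorphD cst, rmorph_nat cst, rmorph1 cst) subrr.
Qed.

(** Since [lap u x P] has degree [q - 1] in u, [lap u u] sends [M u u * lap u x P] to
    [2 (m + 2q - 2)] times [lap u x P], and it sends [polar u x P] to [2 * lap u x P]; this dictates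
    [b]. *)
Lemma harmonic_proj_ux p q b P : b * (m%:R + 2 * q - 2) = 1 ->
  sp4_harmonic p q P ->
  sp4_harmonic (p - 1) (q + 1) (polar u x P - cst b * (M u u * lap u x P)).
Proof.
move=> /weight_cst hb hP; have [Lx Lu Ex Eu] := hP.
have [DLx DLu DEx DEu] := harmonic_lap_ux hP.
split; rewrite !(mD, lap_mulop, lap_polar, polar_mulop, polar_polar x x u x, polar_polar u u u x)
  /= ?(Lx, Lu, Ex, Eu, DLx, DLu, DEx, DEu) ?(simp, mD).
- ring.
- transitivity ((1 - cst b * (m%:R + 2 * cst q - 2)) * (2 * lap u x P)).
    rewrite rmorphB rmorph1; ring.
  by rewrite hb mul0r.
- rewrite !rmorphB !rmorph1; ring.
- rewrite rmorphB rmorphD !rmorph1; ring.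
Qed.

Lemma harmonic_proj_xu p q a P : a * (m%:R + 2 * p - 2) = 1 ->
  sp4_harmonic p q P ->
  sp4_harmonic (p + 1) (q - 1) (polar x u P - cst a * (M x x * lap u x P)).
Proof.
move=> /weight_cst ha hP; have [Lx Lu Ex Eu] := hP.
have [DLx DLu DEx DEu] := harmonic_lap_ux hP.
split; rewrite !(mD, lap_mulop, lap_polar, polar_mulop, polar_polar x x x u, polar_polar u u x u)
  /= ?(Lx, Lu, Ex, Eu, DLx, DLu, DEx, DEu) ?(simp, mD).
- transitivity ((1 - cst a * (m%:R + 2 * cst p - 2)) * (2 * lap u x P)).
    rewrite rmorphB rmorph1; ring.
  by rewrite ha mul0r.
- ring.
- rewrite rmorphB rmorphD !rmorph1; ring.
- rewrite !rmorphB !rmorph1; ring.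
Qed.

(** For the normalized weights this is the Fischer decomposition of [<u,x> P]: the cofactors are
    harmonic by the two projection lemmas and [harmonic_lap_ux]. *)
Lemma mulop_ux_cop a b P : M u x * P = sp4_cop a b P
  + M x x * (cst a * (polar u x P - cst b * (M u u * lap u x P)))
  + M u u * (cst b * (polar x u P - cst a * (M x x * lap u x P)))
  + M x x * (M u u * (cst (a * b) * lap u x P)).
Proof. rewrite /sp4_cop (rmorphM cst); ring. Qed.

Lemma harmonic_cop p q a b P :
  a * (m%:R + 2 * p - 2) = 1 -> b * (m%:R + 2 * q - 2) = 1 ->
  sp4_harmonic p q P -> sp4_harmonic (p + 1) (q + 1) (sp4_cop a b P).
Proof.
move=> /weight_cst ha /weight_cst hb hP; have [Lx Lu Ex Eu] := hP.
have [DLx DLu DEx DEu] := harmonic_lap_ux hP.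
rewrite /sp4_cop; split; rewrite !(mD, lap_mulop, lap_polar, polar_mulop, polar_polar x x x u,
   polar_polar u u x u, polar_polar x x u x, polar_polar u u u x)
  /= ?(Lx, Lu, Ex, Eu, DLx, DLu, DEx, DEu) ?(simp, mD) !(rmorphM cst).
- transitivity ((1 - cst a * (m%:R + 2 * cst p - 2)) *
    (2 * polar u x P - 2 * cst b * (M u u * lap u x P))).
    rewrite rmorphB rmorph1; ring.
  by rewrite ha mul0r.
- transitivity ((1 - cst b * (m%:R + 2 * cst q - 2)) *
    (2 * polar x u P - 2 * cst a * (M x x * lap u x P))).
    rewrite rmorphB rmorph1; ring.
  by rewrite hb mul0r.
- rewrite !rmorphB rmorphD !rmorph1; ring.
- rewrite !rmorphB rmorphD !rmorph1; ring.
Qed.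

(* The Casimir eigenvalue eliminates [<u,d_x><x,d_u> P], the one term of [D C P] that is
   neither a multiple of [P] nor part of [C D P]. *)
Lemma lap_ux_cop p q a b a' b' k P :
  sp4_harmonic p q P -> sp4_casimir P = cst k * P ->
  (1 - 2 * a) * a' = a -> (1 - 2 * b) * b' = b ->
  exists c, lap u x (sp4_cop a b P) =
    cst c * P + cst ((1 - 2 * a) * (1 - 2 * b)) * sp4_cop a' b' (lap u x P).
Proof.
move=> hP kP ha hb; have [Lx Lu Ex Eu] := hP.
(* The first line collects the scalars produced by commutators, the second what the Casimir
   elimination returns. *)
pose c := p + q + m%:R - 2 * a * (p - q)
  + (a + b) * (k + p ^+ 2 + q ^+ 2 + (p - q) - (3%:R - m%:R) * (p + q)).
exists c.
have EF : 2 * polar u x (polar x u P) = 2 * (M u x * lap u x P)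
   - cst (k + p ^+ 2 + q ^+ 2 + (p - q) - (3%:R - m%:R) * (p + q)) * P.
  rewrite !(rmorphB cst, rmorphD cst, rmorphM cst, rmorphXn cst, rmorph_nat cst) !mulrDl -kP.
  rewrite /sp4_casimir (polar_xu_polar_ux hP) Lx Lu !(Ex, Eu, mD) !(rmorphB cst, rmorph_nat cst).
  ring.
transitivity (cst (p + q + m%:R - 2 * a * (p - q)) * P
  - cst (a + b) * (2 * polar u x (polar x u P) - 2 * (M u x * lap u x P))
  + (cst ((1 - 2 * a) * (1 - 2 * b)) * (M u x * lap u x P)
     - cst (a * (1 - 2 * b)) * (M x x * polar u x (lap u x P))
     - cst ((1 - 2 * a) * b) * (M u u * polar x u (lap u x P))
     + cst (a * b) * (M x x * (M u u * lap u x (lap u x P))))).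
  rewrite /sp4_cop !(mD, lap_mulop, lap_polar) /= ?(Lx, Lu) ?(simp, mD).
  rewrite !(lap_mulop, polar_mulop) /= ?(Lx, Lu, Ex, Eu) ?(simp, mD).
  rewrite (polar_xu_polar_ux hP) ?(Ex, Eu).
  rewrite !(rmorphB cst, rmorphD cst, rmorphM cst, rmorph_nat cst, rmorph1 cst).
  ring.
rewrite EF /sp4_cop.
(* In the application [a'] and [b'] are the weights for the lowered degrees of [lap u x P]; the
   remaining four terms thus reassemble into [sp4_cop a' b']. *)
have ha' : (1 - 2 * a) * (1 - 2 * b) * a' = a * (1 - 2 * b) by rewrite mulrAC ha.
have hb' : (1 - 2 * a) * (1 - 2 * b) * b' = (1 - 2 * a) * b by rewrite -mulrA hb.
have hab : (1 - 2 * a) * (1 - 2 * b) * (a' * b') = a * b by rewrite mulrACA ha hb.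
rewrite -ha' -hb' -hab.
rewrite /c !(rmorphB cst, rmorphD cst, rmorphM cst, rmorph_nat cst, rmorph1 cst).
ring.
Qed.
End Sp4.

Section Harmonic.
Variables (R : realType) (m : nat).
Implicit Types (P Q T H G : cpoly R m) (c k : R[i]) (mon : 'X_{1..m + m}).

Local Notation x := false.
Local Notation u := true.
Local Notation cst := (@mpolyC (m + m) R[i]).
Local Notation M := (mulop R m).
Local Notation polar := (@polar R m).
Local Notation lap := (@lap R m).
Local Notation harmonic_of := (sp4_harmonic cst polar lap).
Local Notation cop := (sp4_cop cst M polar lap).
Local Notation casimir := (sp4_casimir cst m M polar lap).

Lemma cpoly_sp4 : sp4_relations cst m M polar lap.
Proof.
split.
- by move=> s t P Q; rewrite linearD.
- by move=> s t c P; rewrite !mul_mpolyC linearZ.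
- by move=> s t P Q; rewrite linearD.
- by move=> s t c P; rewrite !mul_mpolyC linearZ.
- exact: mulopC.
- exact: lapC.
- exact: lap_lap.
- exact: polar_mulop.
- exact: lap_polar.
- exact: lap_mulop.
- exact: polar_polar.
Qed.

(** * Bidegree as an eigenvalue condition for the Euler operators *)

Definition sdeg (s : bool) mon : nat := \sum_(j < m) mon (idx s j).

Lemma mcoeff_polar s P mon : (polar s s P)@_mon = (sdeg s mon)%:R * P@_mon.
Proof.
have varE i : ('X_i * P^`M(i))@_mon = P@_mon *+ mon i.
  case E : (mon i) => [|n].
    rewrite mulr0n; apply/eqP; rewrite mcoeff_eq0 mulrC (perm_mem (msuppMX _ _)).
    by apply/mapP => -[k _ monE]; move: E; rewrite monE mnmDE mnm1E eqxx.
  have le1 : (U_(i) <= mon)%MM by rewrite lep1mP E.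
  rewrite -(submK le1) addmC mulrC mcoeffMX mcoeff_mderiv addmC; congr (_ *+ _).
  by rewrite mnmBE mnm1E eqxx E subn1.
rewrite /polar linear_sum /=; under eq_bigr => j _ do rewrite varE -mulr_natl.
by rewrite -mulr_suml natr_sum.
Qed.

Lemma polar_eigen_nat s n P :
  polar s s P = n%:R%:MP * P -> forall mon, mon \in msupp P -> sdeg s mon = n.
Proof.
move=> eigP mon; rewrite mcoeff_msupp => Pmon.
have /(congr1 (mcoeff mon)) := eigP.
by rewrite mcoeff_polar mcoeffCM => /(mulIf Pmon)/eqP; rewrite eqr_nat => /eqP.
Qed.

(** The Euler operator is diagonal on monomials with natural eigenvalues, and the characteristic is
    zero. *)
Lemma polar_eigen_neg s n P : polar s s P = (- n.+1%:R)%:MP * P -> P = 0.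
Proof.
move=> eigP; apply/mpolyP => mon; rewrite mcoeff0; apply/eqP.
have /(congr1 (mcoeff mon))/eqP := eigP.
rewrite mcoeff_polar mcoeffCM -subr_eq0 -mulrBl opprK -natrD mulf_eq0.
by rewrite pnatr_eq0 addnS.
Qed.

Lemma polar_eigen s n P :
  (forall mon, mon \in msupp P -> sdeg s mon = n) -> polar s s P = n%:R%:MP * P.
Proof.
move=> degP; apply/mpolyP => mon; rewrite mcoeff_polar mcoeffCM.
have [/degP-> //|] := boolP (mon \in msupp P).
by rewrite -mcoeff_eq0 => /eqP->; rewrite !mulr0.
Qed.

Lemma bihomogP p q P :
  bihomog p q P <-> (polar x x P = p%:R%:MP * P /\ polar u u P = q%:R%:MP * P).
Proof.
split=> [hP|[Ex Eu] mon monP]; last first.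
  by split; [exact: (polar_eigen_nat Ex) | exact: (polar_eigen_nat Eu)].
by split; apply: polar_eigen => mon /hP[].
Qed.

(** * The projection [pi_s] through Fischer orthogonality *)

Lemma normx2E : normx2 R m = M x x. Proof. by []. Qed.
Lemma normu2E : normu2 R m = M u u. Proof. by []. Qed.

Lemma harmonic_of_bihomog p q P :
  harmonic_of p%:R q%:R P -> bihomog p q P /\ harmonic P.
Proof. by case=> Lx Lu Ex Eu; split=> //; apply/bihomogP. Qed.

(** A factor [|x|^2] or [|u|^2] crosses the pairing as a Laplacian and annihilates [T]. *)
Lemma fischer_decomp_proj p q P Hf T :
  fischer_decomp p q P Hf -> harmonic T -> fischer T P = fischer T (Hf 0%N 0%N).
Proof.
case=> _ -> [Tx Tu]; rewrite -[Lapx T]/(lap x x T) -[Lapu T]/(lap u u T) in Tx Tu.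
have perp a b Q : (0 < a + b)%N -> fischer T (normx2 R m ^+ a * normu2 R m ^+ b * Q) = 0.
  case: a => [|a] => [|_]; last first.
    by rewrite exprS -!mulrA fischerC normx2E fischer_mulop Tx fischer0r conjC0.
  case: b => [//|b] _.
  by rewrite expr0 mul1r exprS -!mulrA normu2E fischerC fischer_mulop Tu fischer0r conjC0.
rewrite fischer_sumr big_ord_recl /= fischer_sumr big_ord_recl /= !expr0 !mul1r.
rewrite !big1 ?addr0 // => i _; last by have := perp 0%N i.+1 (Hf 0%N i.+1) isT; rewrite expr0.
by rewrite fischer_sumr big1 // => j _; exact: perp.
Qed.

Lemma harmonicB P Q : harmonic P -> harmonic Q -> harmonic (P - Q).
Proof.
move=> [Px Pu] [Qx Qu]; split.
- by have := linearB (lap x x) P Q; rewrite /= [lap x x P]Px [lap x x Q]Qx subr0.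
- by have := linearB (lap u u) P Q; rewrite /= [lap u u P]Pu [lap u u Q]Qu subr0.
Qed.

(** The leading parts of two decompositions pair equally with every harmonic, hence with their own
    difference, which is then orthogonal to itself. The bidegree chosen by [epsilon] may differ from
    [(p,q)], as can happen for the zero polynomial. *)
Lemma pi_s_unique p q P Hf :
  bihomog p q P -> fischer_decomp p q P Hf -> pi_s P = Hf 0%N 0%N.
Proof.
move=> hP dP; rewrite /pi_s.
set S := (fun H => _).
have [p' [q' [Hf' [_ dP' ->]]]] : S (epsilon (inhabits 0) S).
  by apply: epsilon_spec; exists (Hf 0%N 0%N), p, q, Hf.
apply/eqP; rewrite -subr_eq0; apply/eqP; apply: fischer_definite.
set W := _ - _; have harm : harmonic W.
  by apply: harmonicB; [have [/(_ 0 0)%N []] := dP' | have [/(_ 0 0)%N []] := dP].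
rewrite {2}/W -scaleN1r fischerDr fischerZr.
by rewrite -(fischer_decomp_proj dP harm) -(fischer_decomp_proj dP' harm) mulN1r subrr.
Qed.

(** For [p < 2] the range stops at index 0, so the two-term form requires [f 1] to vanish there. *)
Lemma sum_half (V : nmodType) p (f : nat -> V) :
  (forall a, (1 < a)%N -> f a = 0) -> ((p < 2)%N -> f 1%N = 0) ->
  \sum_(a < p./2.+1) f a = f 0%N + f 1%N.
Proof.
move=> f2 f1; rewrite big_ord_recl /=; congr (_ + _).
case: p f1 => [|[|p]] f1; try by rewrite big_ord0 f1.
by rewrite big_ord_recl big1 ?addr0 // => i _; rewrite f2.
Qed.

Lemma eigen_sub2 s p P : polar s s P = (p%:R - 2)%:MP * P -> (p < 2)%N -> P = 0.
Proof.
case: p => [|[|p]] // eigP _.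
  by apply: (@polar_eigen_neg s 1); rewrite eigP sub0r.
by apply: (@polar_eigen_neg s 0); rewrite eigP; congr (_%:MP * _); ring.
Qed.

Lemma pi_sE p q P H (A B D : cpoly R m) :
  harmonic_of p%:R q%:R H -> harmonic_of (p%:R - 2) q%:R A ->
  harmonic_of p%:R (q%:R - 2) B -> harmonic_of (p%:R - 2) (q%:R - 2) D ->
  bihomog p q P -> P = H + M x x * A + M u u * B + M x x * (M u u * D) -> pi_s P = H.
Proof.
move=> hH hA hB hD hP eqP.
pose Hf a b := match a, b with
  | O, O => H | S O, O => A | O, S O => B | S O, S O => D | _, _ => 0 end.
rewrite (@pi_s_unique p q _ Hf) //.
(* The components absent from the decomposition have negative degree. *)
have p0 : (p < 2)%N -> A = 0 /\ D = 0.
  by move=> p2; case: hA hD => _ _ Ax _ [_ _ Dx _]; split;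
    [exact: (eigen_sub2 Ax) | exact: (eigen_sub2 Dx)].
have q0 : (q < 2)%N -> B = 0 /\ D = 0.
  by move=> p2; case: hB hD => _ _ _ Ax [_ _ _ Dx]; split;
    [exact: (eigen_sub2 Ax) | exact: (eigen_sub2 Dx)].
split=> [a b ap bq|].
  have zero p' q' : bihomog p' q' (0 : cpoly R m) /\ harmonic (0 : cpoly R m).
    split; last by split; [exact: (linear0 (lap x x)) | exact: (linear0 (lap u u))].
    by move=> mon; rewrite msupp0.
  (* Index 1 is in range only from degree 2 on, where truncated and scalar subtraction agree. *)
  have le2 n : (0 < n./2)%N -> (n - 2)%:R = n%:R - 2 :> R[i].
    by case: n => [|[|n]] // _; rewrite subSS subSS subn0 -addn2 natrD addrK.
  case: a b ap bq => [|[|a]] [|[|b]] ap bq /=; rewrite ?muln0 ?subn0 ?muln1;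
    try exact: zero; apply: harmonic_of_bihomog; rewrite ?le2 //.
rewrite (@sum_half _ p (fun a => \sum_(b < q./2.+1) normx2 R m ^+ a * normu2 R m ^+ b * Hf a b)).
- rewrite !(@sum_half _ q (fun b => normx2 R m ^+ _ * normu2 R m ^+ b * Hf _ b)) /=.
  + rewrite !expr0 !expr1 !mul1r mulr1 eqP normx2E normu2E; ring.
  + by case=> [|[]] // b _; rewrite mulr0.
  + by move/q0 => -[_ ->]; rewrite mulr0.
  + by case=> [|[]] // b _; rewrite mulr0.
  + by move/q0 => -[-> _]; rewrite mulr0.
- by case=> [|[]] // a _; rewrite big1 // => b _; rewrite mulr0.
- by move/p0 => -[A0 D0]; rewrite big1 // => -[[|[]] ?] _ /=; rewrite ?A0 ?D0 mulr0.
Qed.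

(** * [S_u] and [C] in explicit form *)

Lemma natS n : n.+1%:R = n%:R + 1 :> R[i].
Proof. by rewrite -addn1 natrD. Qed.

Lemma Su_ker_lap p q P :
  harmonic_of p.+1%:R q%:R P -> lap u x P = 0 -> Su P = polar u x P.
Proof.
move=> hP D0; have := harmonic_polar_ux cpoly_sp4 hP D0.
rewrite natS addrK -natS => hE.
have zero a b : harmonic_of a b 0.
  by split; rewrite ?mulr0; [exact: (linear0 (lap x x)) | exact: (linear0 (lap u u))
    | exact: (linear0 (polar x x)) | exact: (linear0 (polar u u))].
rewrite /Su; apply: (pi_sE hE (zero _ _) (zero _ _) (zero _ _)).
  by case: (harmonic_of_bihomog hE).
by rewrite !mulr0 !addr0.
Qed.

Lemma iter_polar_ux_harmonic p q P n : harmonic_of p q P -> lap u x P = 0 ->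
  harmonic_of (p - n%:R) (q + n%:R) (iter n (polar u x) P)
  /\ lap u x (iter n (polar u x) P) = 0.
Proof.
move=> hP D0; elim: n => [|n [hn Dn]]; first by rewrite subr0 addr0.
rewrite iterS; split.
  have := harmonic_polar_ux cpoly_sp4 hn Dn.
  by rewrite -addn1 natrD opprD !addrA.
by rewrite (lap_ux_polar_ux cpoly_sp4 hn) Dn; exact: (linear0 (polar u x)).
Qed.

Lemma iter_Su p q P n : harmonic_of (p + n)%:R q%:R P -> lap u x P = 0 ->
  iter n (@Su R m) P = iter n (polar u x) P.
Proof.
elim: n p => [//|n IH] p hP D0.
rewrite !iterS (IH p.+1) ?addSnnS //.
have [hn Dn] := iter_polar_ux_harmonic n hP D0.
apply: (@Su_ker_lap p (q + n)); last exact: Dn.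
by move: hn; rewrite addnS -addSn natrD addrK -natrD.
Qed.

Definition copw (n : nat) : R[i] := (m%:R + 2 * n%:R - 2)^-1.
(** The weight for degree [n - 1], written so as to cover [n = 0] too; its denominator is then
    [m - 4], nonzero because [m > 4]. *)
Definition copw_pred (n : nat) : R[i] := (m%:R + 2 * n%:R - 4)^-1.

Lemma copwE n : (2 < m)%N -> copw n * (m%:R + 2 * n%:R - 2) = 1.
Proof.
move=> m2; rewrite mulVf // subr_eq0 -natrM -natrD eqr_nat; apply/eqP; lia.
Qed.

Lemma copw_predE n : (4 < m)%N -> (1 - 2 * copw n) * copw_pred n = copw n.
Proof.
move=> m4; have hw := copwE n (ltn_trans (isT : 2 < 4)%N m4).
have hw' : copw_pred n * (m%:R + 2 * n%:R - 4) = 1.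
  by rewrite mulVf // subr_eq0 -natrM -natrD eqr_nat; apply/eqP; lia.
rewrite -[RHS]mulr1 -[X in _ = _ * X]hw' -[X in (X - _) * _]hw; ring.
Qed.

Lemma copw_predS n : copw_pred n.+1 = copw n.
Proof. by rewrite /copw_pred natS; congr (_^-1); ring. Qed.

Lemma CopE p q P : (2 < m)%N -> harmonic_of p%:R q%:R P ->
  Cop P = cop (copw p) (copw q) P /\ harmonic_of p.+1%:R q.+1%:R (Cop P).
Proof.
move=> m2 hP; have hp := copwE p m2; have hq := copwE q m2.
have rel := cpoly_sp4.
have hC : harmonic_of p.+1%:R q.+1%:R (cop (copw p) (copw q) P).
  by have := harmonic_cop rel hp hq hP; rewrite -!natS.
have sub2 n : n.+1%:R - 2 = n%:R - 1 :> R[i] by rewrite natS; ring.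
suff CE : Cop P = cop (copw p) (copw q) P by rewrite CE.
rewrite /Cop; apply: (pi_sE hC _ _ _ _ (mulop_ux_cop cst M polar lap (copw p) (copw q) P)).
- by rewrite sub2 natS; apply: (harmonicZ rel); apply: (harmonic_proj_ux rel).
- by rewrite sub2 natS; apply: (harmonicZ rel); apply: (harmonic_proj_xu rel).
- by rewrite !sub2; apply: (harmonicZ rel); apply: (harmonic_lap_ux rel).
case: hP => _ _ Ex Eu; apply/bihomogP; rewrite !(rel_polar_mulop rel) Ex Eu /= !mulr1n !mulr0n.
by split; rewrite ?addr0 ?add0r natS mpolyCD; ring.
Qed.

(** * The adjoint of [C] and the orthogonality of ladders *)

Lemma fischer_lin4 a b c (P1 P2 P3 P4 Q : cpoly R m) :
  fischer P2 Q = 0 -> fischer P3 Q = 0 -> fischer P4 Q = 0 ->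
  fischer (P1 + a *: P2 + b *: P3 + c *: P4) Q = fischer P1 Q.
Proof. by move=> h2 h3 h4; rewrite !fischerDl !fischerZl h2 h3 h4 !mulr0 !addr0. Qed.

(** The correction terms are multiples of [|x|^2] or [|u|^2], hence orthogonal to the harmonic [Q];
    only [<u,x> P] contributes. *)
Lemma fischer_cop a b p q P Q : harmonic_of p q Q ->
  fischer (cop a b P) Q = fischer P (lap u x Q).
Proof.
case=> Lx Lu _ _.
have -> : cop a b P = M u x * P + (- a) *: (M x x * polar u x P)
    + (- b) *: (M u u * polar x u P) + (a * b) *: (M x x * (M u u * lap u x P)).
  rewrite !scaleNr -[a *: _]mul_mpolyC -[b *: _]mul_mpolyC.
  by rewrite -[(a * b) *: _]mul_mpolyC.
have X0 W : fischer (M x x * W) Q = 0 by rewrite fischer_mulop Lx fischer0r.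
have U0 W : fischer (M u u * W) Q = 0 by rewrite fischer_mulop Lu fischer0r.
rewrite fischer_lin4; [exact: fischer_mulop | exact: X0 | exact: U0 | exact: X0].
Qed.

(** [L] is adjoint to raising in [v] and lowers [w] up to a scalar, so both indices descend
    together. Unequal indices leave one ladder at its bottom first, where the pairing vanishes;
    equal ones end at the two bottom vectors. *)
Lemma ladder_orthogonal (L : cpoly R m -> cpoly R m) (v w : nat -> cpoly R m) :
  (forall i j, fischer (v i.+1) (w j) = fischer (v i) (L (w j))) ->
  (forall j, fischer (v 0%N) (w j.+1) = 0) -> L (w 0%N) = 0 ->
  (forall j, exists c, L (w j.+1) = c *: w j) ->
  forall i j, (i = j -> fischer (v 0%N) (w 0%N) = 0) -> fischer (v i) (w j) = 0.
Proof.
move=> adj v0 Lw0 Lw; elim=> [|i IH] [|j] ij; first exact: ij; first exact: v0.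
  by rewrite adj Lw0 fischer0r.
have [c Lc] := Lw j; rewrite adj Lc fischerZr IH ?mulr0 // => eij.
by apply: ij; rewrite eij.
Qed.

(** Only Euler operators and the sl(2) commutator, worth [p - q], survive in the Casimir. *)
Lemma casimir_highest p q P : harmonic_of p q P -> lap u x P = 0 ->
  polar x u P = 0 -> exists k, casimir P = cst k * P.
Proof.
have rel := cpoly_sp4.
move=> hP D0 F0; have [Lx Lu Ex Eu] := hP.
exists (- p ^+ 2 - q ^+ 2 - (p - q) + (3%:R - m%:R) * (p + q)).
rewrite /sp4_casimir (polar_xu_polar_ux rel hP) Lx Lu D0 F0 Ex Eu !(rel_polarZ rel) Ex Eu.
have -> : polar u x 0 = 0 by exact: (linear0 (polar u x)).
rewrite /= !(mpolyCD, mpolyCN, mpolyCM, rmorphXn) /=; ring.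
Qed.

Lemma iter_Cop p q P : (2 < m)%N -> harmonic_of p%:R q%:R P -> forall n,
  harmonic_of (p + n)%:R (q + n)%:R (iter n (@Cop R m) P) /\
  iter n.+1 (@Cop R m) P = cop (copw (p + n)) (copw (q + n)) (iter n (@Cop R m) P).
Proof.
move=> m2 hP; elim=> [|n [hn nE]].
  by rewrite !addn0; have [] := CopE m2 hP.
have [_ hn1] := CopE m2 hn; rewrite !addnS; split; first exact: hn1.
by have [] := CopE m2 hn1.
Qed.

Lemma lap_ux_iter_Cop p q k P : (4 < m)%N -> harmonic_of p%:R q%:R P ->
  lap u x P = 0 -> casimir P = cst k * P -> forall n,
  exists c, lap u x (iter n.+1 (@Cop R m) P) = c *: iter n (@Cop R m) P.
Proof.
have rel := cpoly_sp4.
move=> m4 hP D0 kP; have m2 : (2 < m)%N := ltn_trans (isT : 2 < 4)%N m4.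
have kn n : casimir (iter n (@Cop R m) P) = cst k * iter n (@Cop R m) P.
  elim: n => [//|n IH]; have [_ ->] := iter_Cop m2 hP n.
  by rewrite (casimir_cop rel) IH (copZ rel).
have step n : exists c,
    lap u x (iter n.+1 (@Cop R m) P) = c *: iter n (@Cop R m) P +
      cst ((1 - 2 * copw (p + n)) * (1 - 2 * copw (q + n))) *
      cop (copw_pred (p + n)) (copw_pred (q + n)) (lap u x (iter n (@Cop R m) P)).
  have [hn ->] := iter_Cop m2 hP n.
  have [c ->] := lap_ux_cop rel hn (kn n) (copw_predE (p + n) m4) (copw_predE (q + n) m4).
  by exists c; rewrite -mul_mpolyC.
elim=> [|n [c IH]].
  have [c ->] := step 0%N; exists c.
  by rewrite /= D0 (cop0 rel) mulr0 addr0.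
(* The lowered weights are those with which [C] acts on [iter n Cop P], so the second term is again
   a multiple of [iter n.+1 Cop P]. *)
have [c' ->] := step n.+1; rewrite IH !addnS !copw_predS -[c *: _]mul_mpolyC (copZ rel).
have [_ <-] := iter_Cop m2 hP n.
set d := _ * (1 - 2 * copw (q + n).+1); exists (c' + d * c).
by rewrite scalerDl -scalerA -[d *: _]mul_mpolyC -[c *: _]mul_mpolyC.
Qed.

Lemma Hspace_harmonic_of p q P : Hspace p q P ->
  [/\ harmonic_of p%:R q%:R P, lap u x P = 0 & polar x u P = 0].
Proof. by case=> /bihomogP[Ex Eu] Lx Lu D0 F0; exact: And3 (And4 Lx Lu Ex Eu) D0 F0. Qed.

Lemma polar_xu_iter_polar_ux p q P : harmonic_of p q P -> lap u x P = 0 ->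
  polar x u P = 0 -> forall n,
  exists c, polar x u (iter n.+1 (polar u x) P) = c *: iter n (polar u x) P.
Proof.
move=> hP D0 F0; elim=> [|n [c IH]].
  exists (p - q); rewrite /= (polar_xu_polar_ux cpoly_sp4 hP) F0 mul_mpolyC.
  by rewrite [polar u x 0](linear0 (polar u x)) add0r.
have [hn _] := iter_polar_ux_harmonic n.+1 hP D0.
(* The commutator of [polar x u] and [polar u x] adds the difference of the two current degrees. *)
exists (c + (p - n.+1%:R - (q + n.+1%:R))).
rewrite iterS (polar_xu_polar_ux cpoly_sp4 hn) IH -[c *: _]mul_mpolyC.
rewrite (rel_polarZ cpoly_sp4) -[polar u x (iter n _ _)]/(iter n.+1 _ _).
by rewrite -mulrDl -mpolyCD mul_mpolyC.
Qed.

Lemma fischer_iter_polar_ux p q p' q' H G i j :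
  harmonic_of p q H -> lap u x H = 0 -> polar x u H = 0 ->
  harmonic_of p' q' G -> lap u x G = 0 -> polar x u G = 0 -> i <> j ->
  fischer (iter i (polar u x) H) (iter j (polar u x) G) = 0.
Proof.
move=> hH DH FH hG DG FG ij.
apply: (@ladder_orthogonal (polar x u) (fun i => iter i (polar u x) H)
  (fun j => iter j (polar u x) G)).
- by move=> i' j'; exact: fischer_polar.
- by move=> j'; rewrite fischerC iterS fischer_polar FH fischer0r conjC0.
- exact: FG.
- exact: polar_xu_iter_polar_ux hG DG FG.
- by move=> /ij.
Qed.

Lemma fischer_iter_Cop p q p' q' k k' H G i j : (4 < m)%N ->
  harmonic_of p%:R q%:R H -> lap u x H = 0 -> casimir H = cst k * H ->
  harmonic_of p'%:R q'%:R G -> lap u x G = 0 -> casimir G = cst k' * G ->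
  (i = j -> fischer H G = 0) ->
  fischer (iter i (@Cop R m) H) (iter j (@Cop R m) G) = 0.
Proof.
move=> m4 hH DH kH hG DG kG; have m2 : (2 < m)%N := ltn_trans (isT : 2 < 4)%N m4.
apply: (@ladder_orthogonal (lap u x) (fun i => iter i (@Cop R m) H)
  (fun j => iter j (@Cop R m) G)).
- move=> i' j'; have [_ ->] := iter_Cop m2 hH i'; have [hj _] := iter_Cop m2 hG j'.
  exact: fischer_cop hj.
- move=> j'; have [_ ->] := iter_Cop m2 hG j'.
  by rewrite fischerC (fischer_cop _ _ _ hH) DH fischer0r conjC0.
- exact: DG.
- exact: lap_ux_iter_Cop hG DG kG.
Qed.

Lemma casimir_iter_polar_ux k P n : casimir P = cst k * P ->
  casimir (iter n (polar u x) P) = cst k * iter n (polar u x) P.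
Proof.
move=> kP; elim: n => [//|n IH].
by rewrite iterS (casimir_polar_ux cpoly_sp4) IH (rel_polarZ cpoly_sp4).
Qed.

(** These are the properties that a bottom vector of the [C] ladder must have. *)
Lemma iter_Su_Hspace p q n P : Hspace (p + n) q P ->
  let Q := iter n (@Su R m) P in
  [/\ Q = iter n (polar u x) P, harmonic_of p%:R (q + n)%:R Q, lap u x Q = 0
    & exists k, casimir Q = cst k * Q].
Proof.
move=> /Hspace_harmonic_of[hP D0 F0] /=; rewrite (iter_Su hP D0).
have [hn Dn] := iter_polar_ux_harmonic n hP D0.
have [k kP] := casimir_highest hP D0 F0.
have kn := casimir_iter_polar_ux n kP.
move: hn; rewrite natrD addrK -natrD => hn.
exact: And4 (erefl _) hn Dn (ex_intro _ k kn).
Qed.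
End Harmonic.

Theorem theorem6p2 (R : realType) (m : nat) (hm : (4 < m)%N) (k l : nat)
  (hlk : (l <= k)%N) (a1 a2 b1 b2 : nat)
  (ha1 : (a1 <= l)%N) (ha2 : (a2 <= l)%N)
  (hb1 : (b1 <= l - a1)%N) (hb2 : (b2 <= l - a2)%N)
  (hne : (a1, b1) <> (a2, b2))
  (H G : cpoly R m)
  (hH : Hspace (k - a1 + b1) (l - a1 - b1) H)
  (hG : Hspace (k - a2 + b2) (l - a2 - b2) G) :
  fischer (iter a1 (@Cop R m) (iter b1 (@Su R m) H))
          (iter a2 (@Cop R m) (iter b2 (@Su R m) G)) = 0.
Proof.
have [EH hSH DH [kH casH]] := iter_Su_Hspace hH.
have [EG hSG DG [kG casG]] := iter_Su_Hspace hG.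
(* The [C] ladder leaves only the case [a1 = a2], with the pairing of the two [S_u] ladders. *)
apply: (fischer_iter_Cop hm hSH DH casH hSG DG casG) => a12; rewrite EH EG.
have [hH0 DH0 FH0] := Hspace_harmonic_of hH.
have [hG0 DG0 FG0] := Hspace_harmonic_of hG.
(* With [a1 = a2], the distinctness of the index pairs forces [b1 <> b2]. *)
apply: (fischer_iter_polar_ux hH0 DH0 FH0 hG0 DG0 FG0) => b12.
by apply: hne; rewrite a12 b12.
Qed.
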